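(* Let $\Gamma>1$ be the constant ratio of specific heats. For the 1D special relativistic hydrodynamic system with the ideal equation of state, the GQL representation of the invariant region $$\widetilde G=\Big\{\mathbf u=(D,m,E)^\top\in\mathbb R^3:\ D>0,\ \ g(\mathbf u)>0,\ \ \widetilde g(\mathbf u)\ge 0\Big\},$$ $$g(\mathbf u):=E-\sqrt{D^2+m^2},\qquad \widetilde g(\mathbf u):=p(\mathbf u)\,(\rho(\mathbf u))^{-\Gamma}-S_{min},$$ is given by $$\widetilde G_*=\Big\{\mathbf u=(D,m,E)^\top:\ D>0,\ \ \widetilde\varphi(\mathbf u;\rho_*,v_* )\ge 0\quad\forall\,\rho_*\in\mathbb R^+,\ \forall\, v_*\in(-1,1)\Big\},$$ where $$\widetilde\varphi(\mathbf u;\rho_*,v_* ):=\mathbf u\cdot\mathbf n_*+S_{min}\rho_*^{\Gamma},\qquad \mathbf n_*:=\Big(-\sqrt{1-v_*^2}\,\Big(1+\frac{S_{min}\Gamma\rho_*^{\Gamma-1}}{\Gamma-1}\Big),\ -v_*,\ 1\Big)^\top;$$ that is, $\widetilde G=\widetilde G_*$.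
   Context: A GQL (geometric quasilinearization, i.e. equivalent linear) representation of a set is an equal set described by constraints that are all affine in $\mathbf u$, possibly quantified over auxiliary parameters independent of $\mathbf u$. The system is $\partial_t\mathbf u+\partial_x\mathbf f(\mathbf u)=\mathbf 0$ with $\mathbf u=(D,m,E)^\top$ and $\mathbf f(\mathbf u)=(Dv,\ mv+p,\ m)^\top$; the speed of light is 1. In terms of rest-mass density $\rho$, velocity $v$, pressure $p$, Lorentz factor $\gamma=(1-v^2)^{-1/2}$, and specific enthalpy $h=1+e+p/\rho$, where $e$ is the specific internal energy and $p=(\Gamma-1)\rho e$, one has $D=\rho\gamma$, $m=\rho h\gamma^2v$, $E=\rho h\gamma^2-p$. The functions $p(\mathbf u)$ and $\rho(\mathbf u)$ are defined implicitly: $p(\mathbf u)$ is the positive root $p$ of $$F(p;\mathbf u):=\frac{m^2}{E+p}+D\Big(1-\frac{m^2}{(E+p)^2}\Big)^{1/2}+\frac{p}{\Gamma-1}-E,$$ and $\rho(\mathbf u)=D\sqrt{1-m^2/(E+p(\mathbf u))^2}$. The constant $S_{min}=\min_x S(\mathbf u_0(x))>0$ is the minimum of the specific entropy $S=p\rho^{-\Gamma}$ over the initial data $\mathbf u_0$; the constraint $\widetilde g(\mathbf u)\ge 0$ expresses the minimum entropy principle $S(\mathbf u)\ge S_{min}$. $\mathbb R^+=(0,\infty)$.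
   Formalization: For Γ>2 the equation F(p;u)=0 can have several positive roots, so p(u) is not well defined; the constraint g̃(u)≥0 is taken to mean that pρ^{-Γ}≥S_min holds at every positive root p, which is the stated constraint whenever the root is unique (always for Γ≤2). *)

(* Defs.v *)
From mathcomp Require Import all_boot all_order all_algebra.
From mathcomp Require Import all_classical all_reals all_analysis.
From mathcomp Require Import ring lra.
Import Order.TTheory GRing.Theory Num.Theory.
Import numFieldNormedType.Exports.

Set Implicit Arguments.
Unset Strict Implicit.
Unset Printing Implicit Defensive.

Local Open Scope classical_set_scope.
Local Open Scope ring_scope.

Section RelativisticHydrodynamics.
Context {R : realType}.
Implicit Types (Gam Smin p q rhos vs : R) (u n : 'cV[R]_3).

(* u = (D, m, E)^T *)
Definition Dens u : R := u 0 0.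
Definition mom u : R := u 1 0.
Definition Ener u : R := u 2%R 0.

Definition vec3 (a b c : R) : 'cV[R]_3 := \col_(i < 3) [:: a; b; c]`_i.

Definition dotp u n : R := \sum_(i < 3) u i 0 * n i 0.

Definition pressure_eq Gam u p : R :=
  mom u ^+ 2 / (Ener u + p)
  + Dens u * Num.sqrt (1 - mom u ^+ 2 / (Ener u + p) ^+ 2)
  + p / (Gam - 1) - Ener u.

(* p(u) is introduced implicitly, as the positive root of [pressure_eq].  When
   D > 0 and g(u) > 0 such a root exists for every Gam > 1 (lemma
   [is_pressure_exists]), and it is unique for Gam <= 2 (lemma
   [is_pressure_unique]).  It need not be unique for Gam > 2, so p(u) is kept
   as a relation instead of being turned into a function by choosing a root. *)
Definition is_pressure Gam u p : Prop := 0 < p /\ pressure_eq Gam u p = 0.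

Definition density u p : R :=
  Dens u * Num.sqrt (1 - mom u ^+ 2 / (Ener u + p) ^+ 2).

Definition gfun u : R := Ener u - Num.sqrt (Dens u ^+ 2 + mom u ^+ 2).

Definition gtilde Gam Smin u p : R := p * density u p `^ (- Gam) - Smin.

(* The entropy constraint is imposed at p = p(u), i.e. at the positive root;
   were there several roots, it is imposed at each of them. *)
Definition Gtilde Gam Smin : set 'cV[R]_3 :=
  [set u | [/\ 0 < Dens u, 0 < gfun u &
            forall p, is_pressure Gam u p -> 0 <= gtilde Gam Smin u p]].

Definition nstar Gam Smin rhos vs : 'cV[R]_3 :=
  vec3 (- (Num.sqrt (1 - vs ^+ 2)
           * (1 + Smin * Gam * rhos `^ (Gam - 1) / (Gam - 1))))
       (- vs) 1.

Definition phitilde Gam Smin u rhos vs : R :=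
  dotp u (nstar Gam Smin rhos vs) + Smin * rhos `^ Gam.

Definition Gtilde_star Gam Smin : set 'cV[R]_3 :=
  [set u | 0 < Dens u /\
           forall rhos vs, 0 < rhos -> -1 < vs < 1 ->
             0 <= phitilde Gam Smin u rhos vs].

Lemma gfun_gt0 u : 0 < Dens u -> 0 < gfun u ->
  0 < Ener u /\ Dens u ^+ 2 + mom u ^+ 2 < Ener u ^+ 2.
Proof.
rewrite /gfun subr_gt0 => D0 g0.
have E0 : 0 < Ener u by exact: le_lt_trans (sqrtr_ge0 _) g0.
split=> //; have DM : 0 <= Dens u ^+ 2 + mom u ^+ 2 by nra.
by rewrite -(sqr_sqrtr DM) ltr_pXn2r // nnegrE ?sqrtr_ge0 // ltW.
Qed.

Lemma is_pressure_exists Gam u : 1 < Gam -> 0 < Dens u -> 0 < gfun u ->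
  exists p, is_pressure Gam u p.
Proof.
move=> G1 D0 g0; have [E0 DmE] := gfun_gt0 D0 g0.
have F0 : pressure_eq Gam u 0 < 0.
  rewrite /pressure_eq addr0 mul0r addr0.
  move: D0 E0 DmE; move: (Ener u) (Dens u) (mom u) => E D m D0 E0 DmE.
  have E2 : 0 < E ^+ 2 by exact: exprn_gt0.
  have D2 : 0 < D ^+ 2 by exact: exprn_gt0.
  have lt1 : m ^+ 2 / E ^+ 2 < 1 by rewrite ltr_pdivrMr // mul1r; lra.
  set s := Num.sqrt _.
  have s0 : 0 < s by rewrite sqrtr_gt0 subr_gt0.
  have sE : s ^+ 2 = 1 - m ^+ 2 / E ^+ 2 by rewrite sqr_sqrtr // subr_ge0 ltW.
  have mE : m ^+ 2 / E = E * (1 - s ^+ 2) by rewrite sE; field; rewrite gt_eqF.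
  have DE2 : D ^+ 2 < (E * s) ^+ 2.
    suff -> : (E * s) ^+ 2 = E ^+ 2 - m ^+ 2 by lra.
    by rewrite exprMn sE; field; rewrite gt_eqF.
  rewrite mE; move: s0 DE2; clear -D0 E0; move: s => s s0 DE2.
  have DE : D < E * s.
    by move: DE2; rewrite ltr_pXn2r // nnegrE ltW // mulr_gt0.
  have -> : E * (1 - s ^+ 2) + D * s - E = s * (D - E * s) by ring.
  by rewrite pmulr_rlt0 // subr_lt0.
pose P := (Gam - 1) * Ener u.
have G0 : 0 < Gam - 1 by rewrite subr_gt0.
have P0 : 0 < P by exact: mulr_gt0.
have FP : 0 <= pressure_eq Gam u P.
  rewrite /pressure_eq.
  have -> : P / (Gam - 1) = Ener u by rewrite /P; field; rewrite gt_eqF.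
  have EP : 0 <= Ener u + P by rewrite addr_ge0 // ltW.
  rewrite addrK addr_ge0 //; first by rewrite divr_ge0 // sqr_ge0.
  by rewrite mulr_ge0 ?sqrtr_ge0 // ltW.
have cF : {within `[0, P], continuous (pressure_eq Gam u)}.
  apply: continuous_in_subspaceT => x; rewrite inE /= in_itv /= => /andP[x0 _].
  have Ex : Ener u + x != 0 by rewrite gt_eqF // ltr_wpDr.
  have cE : {for x, continuous (fun p => Ener u + p)}.
    by apply: cvgD; [exact: cvg_cst | exact: cvg_id].
  have cI : {for x, continuous (fun p => (Ener u + p)^-1)}.
    by apply: cvgV.
  have cI2 : {for x, continuous (fun p => ((Ener u + p) ^+ 2)^-1)}.
    apply: cvgV; first by rewrite expf_neq0.
    by rewrite /=; under eq_fun do rewrite expr2; rewrite expr2; apply: cvgM.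
  apply: cvgB; last exact: cvg_cst.
  apply: cvgD; last by apply: cvgM; [exact: cvg_id | exact: cvg_cst].
  apply: cvgD; first by apply: cvgM; [exact: cvg_cst | exact: cI].
  apply: cvgM; first exact: cvg_cst.
  apply: (@cvg_comp _ _ _ (fun p : R => 1 - mom u ^+ 2 / (Ener u + p) ^+ 2)
            Num.sqrt) (@sqrt_continuous R _).
  apply: cvgB; first exact: cvg_cst.
  by apply: cvgM; [exact: cvg_cst | exact: cI2].
have [|p pI pE] := @IVT _ _ _ _ 0 (ltW P0) cF.
  have FF := le_trans (ltW F0) FP.
  by rewrite min_l // max_r // (ltW F0) FP.
exists p; split=> //; move: pI; rewrite in_itv /= => /andP[p0 _].
rewrite lt_neqAle p0 andbT; apply/eqP => p00.
by move: pE; rewrite -p00 => FE; rewrite FE ltxx in F0.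
Qed.

Lemma is_pressure_unique Gam u p q : 1 < Gam -> Gam <= 2 ->
  0 < Dens u -> 0 < gfun u ->
  is_pressure Gam u p -> is_pressure Gam u q -> p = q.
Proof.
move=> G1 G2 D0 g0; have [E0 DmE] := gfun_gt0 D0 g0.
wlog pq : p q / p < q => [wl|] [p0 pE] [q0 qE].
  by have [pq|qp|//] := ltgtP p q; [exact: wl | apply/esym; exact: wl].
suff : pressure_eq Gam u p < pressure_eq Gam u q by rewrite pE qE ltxx.
rewrite /pressure_eq.
clear pE qE; move: D0 E0 DmE {g0}.
move: (Ener u) (Dens u) (mom u) => E D m D0 E0 DmE.
have Ep : 0 < E + p by exact: addr_gt0.
have Eq : 0 < E + q by exact: addr_gt0.
have s_le : D * Num.sqrt (1 - m ^+ 2 / (E + p) ^+ 2)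
            <= D * Num.sqrt (1 - m ^+ 2 / (E + q) ^+ 2).
  rewrite ler_pM2l //; apply: ler_wsqrtr; rewrite lerD2l lerN2.
  apply: ler_wpM2l; first exact: sqr_ge0.
  rewrite lef_pV2 ?posrE ?exprn_gt0 //.
  by apply: lerXn2r; rewrite ?nnegrE ?ltW // ltrD2l.
have m_lt : m ^+ 2 / (E + p) - m ^+ 2 / (E + q) < q - p.
  have -> : m ^+ 2 / (E + p) - m ^+ 2 / (E + q)
            = (q - p) * (m ^+ 2 / ((E + p) * (E + q))).
    by field; rewrite !gt_eqF.
  rewrite gtr_pMr ?subr_gt0 // ltr_pdivrMr ?mulr_gt0 // mul1r.
  by clear -DmE E0 p0 q0 D0; nra.
have G_le : q - p <= q / (Gam - 1) - p / (Gam - 1).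
  rewrite -mulrBl ler_pMr ?subr_gt0 // invf_ge1 ?subr_gt0 //.
  by rewrite lerBlDr.
lra.
Qed.

End RelativisticHydrodynamics.

(* Main.v *)
Require Import Defs.
From mathcomp Require Import all_boot all_order all_algebra.
From mathcomp Require Import all_classical all_reals all_analysis.
From mathcomp Require Import ring lra.
Import Order.TTheory GRing.Theory Num.Theory.
Import numFieldNormedType.Exports.

(** Fix u = (D, m, E) with D > 0.  To each velocity v in (-1, 1) attach the trial
state with rest-mass density r = D sqrt(1 - v^2) and with internal energy
T(v) = E - m v - r, hence with pressure (Gam - 1) T(v).  This state has the
right D, and an energy consistent with m and E; it is a genuine state of u
exactly when moreover m = v (E + pressure).

The linear constraints bound the entropy of all trial states.  For a fixed
velocity parameter v, the minimum of phitilde over the density parameter is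
attained at r (Young's inequality), and it is
T(v) - Smin r^Gam / (Gam - 1); so the constraints say that every trial state has
entropy at least Smin ([phitilde_ge0P]).

The set with p(u) bounds the entropy of the genuine states only.  The link is a
variational principle: the genuine states are the critical points of the entropy
of the trial state as a function of v ([is_derive_inv_trial_entropy]).  That
entropy blows up as v tends to -1 or 1, because T is bounded below by
g(u) > 0 ([gfun_le_trial_energy]) while r tends to 0.  So its minimum is
attained, at a genuine state ([max_inv_trial_entropy]), and if the entropy is at
least Smin there, it is so at every v.  Conversely a genuine state is a trial
state, and g(u) > 0 is positivity of T at the v maximising m v + r
([gfun_gt0_trial]).

The argument never compares two roots of the pressure equation, so it covers
Gam > 2, where there may be several. *)

Local Open Scope classical_set_scope.
Local Open Scope ring_scope.

(** * Young's inequality and interior maxima *)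

(** Young's inequality with exponents a and a / (a - 1), cleared of
denominators; both sides agree at x = y. *)
Lemma young_powR (R : realType) (a x y : R) : 1 < a -> 0 <= x -> 0 <= y ->
  a * (x * y `^ (a - 1)) <= x `^ a + (a - 1) * y `^ a.
Proof.
move=> a1 x0 y0; have a10 : 0 < a - 1 by rewrite subr_gt0.
have a0 : 0 < a by exact: lt_trans a1.
have q0 : 0 < a / (a - 1) by exact: divr_gt0.
have pq : a^-1 + (a / (a - 1))^-1 = 1 by field; rewrite !gt_eqF.
have := conjugate_powR x0 (powR_ge0 y (a - 1)) a0 q0 pq.
have e : (a - 1) * (a / (a - 1)) = a by field; rewrite gt_eqF.
rewrite -powRrM e -(ler_pM2l a0).
by congr (_ <= _); field; rewrite !gt_eqF.
Qed.

(** Fermat's rule on an open interval: values near the ends do not exceed the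
value at the centre, which is what makes the supremum attained inside. *)
Lemma interior_max (R : realType) (f : R -> R) (b r : R) : 0 <= b -> b < r ->
  (forall x, x \in `]- r, r[ -> derivable f x 1) ->
  (forall x, x \in `]- r, r[ -> b < `|x| -> f x <= f 0) ->
  exists c, [/\ c \in `]- r, r[, is_derive c 1 f 0 &
                forall x, x \in `]- r, r[ -> f x <= f c].
Proof.
move=> b0 br df fout.
have sub x : x \in `[- b, b] -> x \in `]- r, r[.
  by rewrite !in_itv /= => /andP[? ?]; apply/andP; split; lra.
have [||c cI cmax] := @EVT_max R f (- b) b.
- by rewrite ge0_cp.
- by apply: derivable_within_continuous => x /sub; exact: df.
have le_c x : x \in `]- r, r[ -> f x <= f c.
  move=> xI; have [xb|bx] := leP `|x| b.
    by apply: cmax; rewrite in_itv /= -ler_norml.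
  apply: le_trans (fout x xI bx) _; apply: cmax.
  by rewrite in_itv /= oppr_le0 b0.
exists c; split=> //; first exact: sub.
apply: (@derive1_at_max R f (- r) r) => //; last exact: sub.
by rewrite ge0_cp // (le_trans b0) // ltW.
Qed.

(** * Trial states *)

Section TrialStates.
Context {R : realType}.
Implicit Types (Gam Smin p v rho : R) (u : 'cV[R]_3).

Definition lorentz_inv v : R := Num.sqrt (1 - v ^+ 2).

Definition trial_density u v : R := Dens u * lorentz_inv v.

(** For a physical state, E = m v + r + p / (Gam - 1); solving for the last term,
this is the internal energy density that the velocity v would require. *)
Definition trial_energy u v : R := Ener u - mom u * v - trial_density u v.

Lemma lorentz_inv_gt0 v : -1 < v < 1 -> 0 < lorentz_inv v.
Proof. by move=> /andP[v0 v1]; rewrite sqrtr_gt0; nra. Qed.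

Lemma sqr_lorentz_inv v : -1 < v < 1 -> lorentz_inv v ^+ 2 = 1 - v ^+ 2.
Proof. by move=> /andP[v0 v1]; rewrite sqr_sqrtr //; nra. Qed.

Lemma trial_density_gt0 u v : 0 < Dens u -> -1 < v < 1 ->
  0 < trial_density u v.
Proof. by move=> D0 vI; rewrite mulr_gt0 ?lorentz_inv_gt0. Qed.

(** * The linear constraints *)

Lemma phitilde_trial Gam Smin u rho v : 1 < Gam ->
  phitilde Gam Smin u rho v = trial_energy u v
    - Smin / (Gam - 1) * (Gam * (trial_density u v * rho `^ (Gam - 1)))
    + Smin * rho `^ Gam.
Proof.
move=> Gam1; have Gam10 : Gam - 1 != 0 by rewrite subr_eq0 gt_eqF.
rewrite /phitilde /dotp /nstar /vec3 !big_ord_recr big_ord0 /= !mxE /=.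
rewrite /trial_energy /trial_density /lorentz_inv /Ener /mom /Dens.
have -> : widen_ord (leqnSn 2) (widen_ord (leqnSn 1) ord_max) = 0 :> 'I_3.
  exact: val_inj.
have -> : widen_ord (leqnSn 2) ord_max = 1 :> 'I_3 by exact: val_inj.
have -> : ord_max = 2%R :> 'I_3 by exact: val_inj.
by field.
Qed.

(** Minimisation over rho: the value rho = r gives one direction, and Young's
inequality shows that this value is the worst one. *)
Lemma phitilde_ge0P Gam Smin u v : 1 < Gam -> 0 < Smin -> 0 < Dens u ->
  -1 < v < 1 ->
  (forall rho, 0 < rho -> 0 <= phitilde Gam Smin u rho v) <->
  Smin / (Gam - 1) * trial_density u v `^ Gam <= trial_energy u v.
Proof.
move=> Gam1 Smin0 D0 vI; set r := trial_density u v.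
have r0 : 0 < r by exact: trial_density_gt0.
have K0 : 0 < Smin / (Gam - 1) by rewrite divr_gt0 ?subr_gt0.
have SminE : Smin = Smin / (Gam - 1) * (Gam - 1).
  by field; rewrite subr_eq0 gt_eqF.
split=> [/(_ r r0)|rE rho rho0]; rewrite phitilde_trial // -/r.
  have -> : r * r `^ (Gam - 1) = r `^ Gam.
    by rewrite mulr_powRB1 ?(ltW r0) // (lt_trans _ Gam1).
  rewrite {2}SminE; lra.
have := young_powR _ Gam _ _ Gam1 (ltW r0) (ltW rho0).
rewrite -(ler_pM2l K0) {4}SminE mulrDr !mulrA; lra.
Qed.

(** Cauchy-Schwarz for (m, D) and the unit vector (v, sqrt(1 - v^2)). *)
Lemma gfun_le_trial_energy u v : -1 < v < 1 -> gfun u <= trial_energy u v.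
Proof.
move=> vI; rewrite /gfun /trial_energy /trial_density.
have := sqr_lorentz_inv _ vI; move: (lorentz_inv v) (Dens u) (mom u) => s D m s2.
suff : m * v + D * s <= Num.sqrt (D ^+ 2 + m ^+ 2) by lra.
apply: le_trans (ler_norm _) _; rewrite -sqrtr_sqr; apply: ler_wsqrtr.
(* Lagrange's identity. *)
have -> : D ^+ 2 + m ^+ 2 = (m * v + D * s) ^+ 2 + (m * s - D * v) ^+ 2.
  transitivity ((D ^+ 2 + m ^+ 2) * (v ^+ 2 + s ^+ 2)); last by ring.
  by rewrite s2; ring.
by rewrite lerDl sqr_ge0.
Qed.

(** The equality case of Cauchy-Schwarz: at v = m / sqrt(D^2 + m^2) the trial
energy is g(u) itself. *)
Lemma gfun_gt0_trial u : 0 < Dens u ->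
  (forall v, -1 < v < 1 -> 0 < trial_energy u v) -> 0 < gfun u.
Proof.
move=> D0 T0; set n := Num.sqrt (Dens u ^+ 2 + mom u ^+ 2).
have n2 : n ^+ 2 = Dens u ^+ 2 + mom u ^+ 2.
  by rewrite sqr_sqrtr // addr_ge0 ?sqr_ge0.
have n0 : 0 < n.
  by rewrite sqrtr_gt0 ltr_wpDr ?sqr_ge0 // exprn_gt0.
have nN0 : n != 0 by rewrite gt_eqF.
have vI : -1 < mom u / n < 1.
  by rewrite ltr_pdivlMr // ltr_pdivrMr //; apply/andP; split; nra.
have sE : lorentz_inv (mom u / n) = Dens u / n.
  rewrite /lorentz_inv.
  have -> : 1 - (mom u / n) ^+ 2 = (Dens u / n) ^+ 2.
    by rewrite !expr_div_n -[Dens u ^+ 2](addrK (mom u ^+ 2)) -n2; field.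
  by rewrite sqrtr_sqr ger0_norm // divr_ge0 // ltW.
have := T0 _ vI; rewrite /trial_energy /trial_density sE /gfun -/n.
suff : n = mom u * (mom u / n) + Dens u * (Dens u / n) by lra.
by apply: (mulIf nN0); rewrite -expr2 n2; field.
Qed.

(** * Genuine states *)

Lemma density_trial u p : density u p = trial_density u (mom u / (Ener u + p)).
Proof. by rewrite /density /trial_density /lorentz_inv expr_div_n. Qed.

(** A root p of the pressure equation is the pressure (Gam - 1) T(v) of the trial
state at v = m / (E + p). *)
Lemma pressure_eq_trial Gam u p :
  pressure_eq Gam u p =
  p / (Gam - 1) - trial_energy u (mom u / (Ener u + p)).
Proof.
by rewrite /pressure_eq -/(density u p) density_trial /trial_energy; ring.
Qed.

Lemma gtilde_ge0 Gam Smin u p : 0 < density u p ->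
  (0 <= gtilde Gam Smin u p) = (Smin * density u p `^ Gam <= p).
Proof.
move=> r0.
by rewrite /gtilde subr_ge0 powRN ler_pdivlMr // powR_gt0.
Qed.

Lemma velocity_lt1 u p : 0 < Dens u -> 0 < gfun u -> 0 < p ->
  -1 < mom u / (Ener u + p) < 1.
Proof.
move=> D0 g0 p0; have [E0 DmE] := gfun_gt0 D0 g0.
have Ep0 : 0 < Ener u + p by exact: addr_gt0.
rewrite ltr_pdivlMr // ltr_pdivrMr //.
by apply/andP; split; nra.
Qed.

(** * The variational principle *)

(** The reciprocal of the entropy (Gam - 1) T(v) / r^Gam of the trial state, up
to a factor that does not depend on v.  The reciprocal is used because, when
g(u) > 0, it stays bounded and tends to 0 at the two ends of (-1, 1). *)
Definition inv_trial_entropy Gam u v : R :=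
  lorentz_inv v `^ Gam / trial_energy u v.

(** The bound of [phitilde_ge0P], with its dependence on v collected in one
function. *)
Lemma trial_entropy_geE Gam Smin u v : 1 < Gam -> 0 < Dens u -> -1 < v < 1 ->
  0 < trial_energy u v ->
  (Smin / (Gam - 1) * trial_density u v `^ Gam <= trial_energy u v) =
  (Smin * Dens u `^ Gam * inv_trial_entropy Gam u v <= Gam - 1).
Proof.
move=> Gam1 D0 vI T0; rewrite /trial_density /inv_trial_entropy.
rewrite (powRM _ (ltW D0)) ?sqrtr_ge0 //.
by rewrite mulrAC ler_pdivrMr ?subr_gt0 // !mulrA ler_pdivrMr // [leRHS]mulrC.
Qed.

(** The last factor is the one that matters: its vanishing says that the
trial state with velocity v is a genuine one. *)
Lemma is_derive_inv_trial_entropy Gam u v : 0 < Gam -> -1 < v < 1 ->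
  0 < trial_energy u v ->
  is_derive v 1 (inv_trial_entropy Gam u)
    (lorentz_inv v `^ (Gam - 1) / (lorentz_inv v * trial_energy u v ^+ 2) *
     (mom u - v * (Ener u + (Gam - 1) * trial_energy u v))).
Proof.
move=> Gam0 vI T0; have s0 := lorentz_inv_gt0 _ vI.
have v2 : 0 < 1 - v ^+ 2 by rewrite -sqr_lorentz_inv // exprn_gt0.
have ds : is_derive v 1 lorentz_inv (- v / lorentz_inv v).
  have dq : is_derive v 1 (fun x : R => 1 - x ^+ 2) (- (2 * v)).
    by apply: is_derive_eq; rewrite /GRing.scale /=; ring.
  have dc := is_derive1_comp (f := Num.sqrt) (g := fun x : R => 1 - x ^+ 2)
    (is_derive1_sqrt v2) dq.
  apply: (is_derive_eq dc).
  by rewrite -/(lorentz_inv v); field; rewrite gt_eqF.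
have dT : is_derive v 1 (trial_energy u)
    (Dens u * v / lorentz_inv v - mom u).
  by apply: is_derive_eq; rewrite /GRing.scale /=; field; rewrite gt_eqF.
have dP : is_derive v 1 (fun x => lorentz_inv x `^ Gam)
    (Gam * lorentz_inv v `^ (Gam - 1) * (- v / lorentz_inv v)).
  exact: is_derive1_comp (is_derive1_powR _ s0) ds.
apply: is_derive_eq (is_deriveM dP (is_deriveV _ dT)) _; first by rewrite gt_eqF.
rewrite /GRing.scale /=.
rewrite -(mulr_powRB1 (ltW s0) Gam0).
have mE : v ^+ 2 = 1 - lorentz_inv v ^+ 2 by rewrite sqr_lorentz_inv //; ring.
have EE : Ener u = trial_energy u v + mom u * v + Dens u * lorentz_inv v.
  by rewrite /trial_energy /trial_density; ring.
by rewrite EE; field : mE; rewrite !gt_eqF.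
Qed.

(** The least entropy among the trial states is attained, and at a genuine
state. *)
Lemma max_inv_trial_entropy Gam u : 1 < Gam -> 0 < Dens u -> 0 < gfun u ->
  exists v, [/\ -1 < v < 1,
    mom u = v * (Ener u + (Gam - 1) * trial_energy u v) &
    forall w, -1 < w < 1 ->
      inv_trial_entropy Gam u w <= inv_trial_entropy Gam u v].
Proof.
move=> Gam1 D0 g0; have Gam0 : 0 < Gam by exact: lt_trans Gam1.
have T0 v : -1 < v < 1 -> 0 < trial_energy u v.
  by move=> vI; exact: lt_le_trans g0 (gfun_le_trial_energy u v vI).
have l01 : -1 < (0 : R) < 1 by rewrite ltrN10 ltr01.
have s01 : lorentz_inv 0 = 1 by rewrite /lorentz_inv expr0n subr0 sqrtr1.
(* When 1 / gamma <= t, one has (1 / gamma)^Gam / T <= t / g(u) = 1 / T(0), so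
   velocities beyond sqrt(1 - t^2) cannot beat v = 0. *)
pose t := gfun u / trial_energy u 0.
have t0 : 0 < t by rewrite divr_gt0 ?T0.
have t1 : t <= 1 by rewrite ler_pdivrMr ?T0 // mul1r gfun_le_trial_energy.
have b2 : Num.sqrt (1 - t ^+ 2) ^+ 2 = 1 - t ^+ 2 by rewrite sqr_sqrtr //; nra.
have b1 : Num.sqrt (1 - t ^+ 2) < 1.
  by rewrite -(@ltr_pXn2r _ 2) // ?nnegrE ?sqrtr_ge0 // b2 expr1n; nra.
have [x|x|v [vI dv vmax]] := interior_max _ (inv_trial_entropy Gam u) _ _
    (sqrtr_ge0 _) b1.
- rewrite in_itv /= => xI.
  by case: (is_derive_inv_trial_entropy _ u _ Gam0 xI (T0 _ xI)).
- rewrite in_itv /= => xI bx; have s0 := lorentz_inv_gt0 _ xI.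
  have s2 := sqr_lorentz_inv _ xI.
  have st : lorentz_inv x <= t.
    rewrite -(@ler_pXn2r _ 2) // ?nnegrE ?(ltW s0) ?(ltW t0) // s2.
    have : Num.sqrt (1 - t ^+ 2) ^+ 2 <= `|x| ^+ 2.
      by rewrite ler_pXn2r // ?nnegrE ?sqrtr_ge0 // ltW.
    by rewrite b2 real_normK ?num_real //; lra.
  rewrite /inv_trial_entropy s01 powR1 ler_pdivrMr ?T0 //.
  have sG : lorentz_inv x `^ Gam <= lorentz_inv x.
    by apply: ge1r_powR; rewrite ?s0 ?(le_trans st) // ltW.
  apply: le_trans sG (le_trans st _).
  by rewrite div1r [leRHS]mulrC ler_pM2r ?invr_gt0 ?T0 // gfun_le_trial_energy.
- move: vI; rewrite in_itv /= => vI; exists v; split=> //.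
  have s0 := lorentz_inv_gt0 _ vI.
  have := derive_val (is_derive := dv).
  rewrite (derive_val (is_derive :=
    is_derive_inv_trial_entropy _ u _ Gam0 vI (T0 _ vI))).
  move/eqP; rewrite mulf_eq0 gt_eqF /=; first by rewrite subr_eq0 => /eqP.
  by rewrite divr_gt0 ?powR_gt0 // mulr_gt0 // exprn_gt0 // T0.
Qed.

End TrialStates.

(** * Equality of the two sets *)

Theorem theorem4p10 (R : realType) (Gam Smin : R) (hGam : 1 < Gam)
    (hSmin : 0 < Smin) :
  Gtilde Gam Smin = Gtilde_star Gam Smin.
Proof.
have Gam10 : 0 < Gam - 1 by rewrite subr_gt0.
apply/seteqP; split=> u /=.
  case=> D0 g0 ent; split=> // rho v rho0 vI; move: rho rho0.
  apply/(phitilde_ge0P _ _ _ _ hGam hSmin D0 vI).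
  (* The trial state of least entropy is a genuine state, at which the entropy
     constraint can be used. *)
  have [w [wI mE wmax]] := max_inv_trial_entropy _ _ hGam D0 g0.
  have T0 x : -1 < x < 1 -> 0 < trial_energy u x.
    by move=> xI; exact: lt_le_trans g0 (gfun_le_trial_energy u x xI).
  set p := (Gam - 1) * trial_energy u w in mE.
  have p0 : 0 < p by rewrite mulr_gt0 ?T0.
  have [E0 _] := gfun_gt0 D0 g0.
  have wE : mom u / (Ener u + p) = w.
    by rewrite mE mulfK // gt_eqF // addr_gt0.
  have pP : is_pressure Gam u p.
    by split=> //; rewrite pressure_eq_trial wE /p; field; rewrite gt_eqF.
  have := ent p pP; rewrite gtilde_ge0 density_trial wE ?trial_density_gt0 //.
  rewrite /p [leRHS]mulrC -ler_pdivrMr // mulrAC.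
  rewrite !trial_entropy_geE ?T0 //; apply: le_trans.
  by rewrite ler_pM2l ?wmax // mulr_gt0 ?powR_gt0.
case=> D0 star.
have bound v : -1 < v < 1 ->
    Smin / (Gam - 1) * trial_density u v `^ Gam <= trial_energy u v.
  move=> vI; apply/(phitilde_ge0P _ _ _ _ hGam hSmin D0 vI) => rho rho0.
  exact: star.
have g0 : 0 < gfun u.
  apply: gfun_gt0_trial => // v vI; apply: lt_le_trans (bound v vI).
  by rewrite mulr_gt0 ?divr_gt0 ?powR_gt0 ?trial_density_gt0.
split=> // p [p0 pE]; have vI := velocity_lt1 _ _ D0 g0 p0.
rewrite gtilde_ge0 density_trial ?trial_density_gt0 //.
move: pE (bound _ vI); rewrite pressure_eq_trial => /eqP.
by rewrite subr_eq0 => /eqP <-; rewrite mulrAC ler_pM2r // invr_gt0.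
Qed.
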